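(* Let $X$ be a topological space and $\mathcal U$ an open cover of $X$ by simply connected open subsets. If $\mathcal U$ is closed under finite intersections, then for each $x\in X$ the group $\pi_1(X,x)$ is isomorphic to the fundamental group of the nerve $N\mathcal U$ of the cover (based at any vertex $U\in\mathcal U$ with $x\in U$).
   Context: The nerve $N\mathcal U$ of a cover $\mathcal U$ is the simplicial complex whose simplices are the nonempty finite subsets of $\mathcal U$ with nonempty intersection. Simply connected means path connected with trivial fundamental group; the empty set is allowed to occur as an intersection (it contributes no vertex to the nerve), so the closure condition means that every nonempty intersection of finitely many members of $\mathcal U$ is again a member of $\mathcal U$. *)

(* Defs.v *)
From HB Require Import structures.
From mathcomp Require Import all_boot all_order all_algebra generic_quotient.
From mathcomp Require Import all_classical all_reals all_analysis homotopy.
From mathcomp Require Import ring lra.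

Set Implicit Arguments.
Unset Strict Implicit.
Unset Printing Implicit Defensive.

Import Order.TTheory GRing.Theory Num.Theory.
Import numFieldNormedType.Exports.

Local Open Scope classical_set_scope.
Local Open Scope ring_scope.
Local Open Scope quotient_scope.

Definition unit_interval (R : realType) : Type := set_type `[0%R : R, 1]%classic.

Section UnitInterval.
Context (R : realType).
Local Notation I := (unit_interval R).

HB.instance Definition _ := Topological.copy I (set_type `[0%R : R, 1]%classic).

Definition ival (t : I) : R := set_val t.

Lemma clamp_subproof (t : R) : Num.max 0 (Num.min 1 t) \in `[0%R : R, 1]%classic.
Proof.
rewrite inE /= in_itv /= le_max lexx /=.
by rewrite ge_max ler01 ge_min lexx.
Qed.

(* The retraction of the real line onto the unit interval. *)
Definition clamp (t : R) : I := exist (fun r => r \in `[0%R : R, 1]%classic) _ (clamp_subproof t).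

Lemma ival_inj : injective ival.
Proof. by move=> s t; exact: val_inj. Qed.

Lemma ival_ge0 (t : I) : 0 <= ival t.
Proof. by have /set_mem := valP t; rewrite /= in_itv /= => /andP[]. Qed.

Lemma ival_le1 (t : I) : ival t <= 1.
Proof. by have /set_mem := valP t; rewrite /= in_itv /= => /andP[]. Qed.

Lemma clampK (t : R) : 0 <= t <= 1 -> ival (clamp t) = t.
Proof.
move=> /andP[t0 t1]; rewrite /ival /clamp set_valE /=.
by rewrite (min_idPr t1) (max_idPr t0).
Qed.

Lemma ivalK : cancel ival clamp.
Proof. by move=> t; apply: ival_inj; rewrite clampK// ival_ge0 ival_le1. Qed.

Lemma ival_continuous : continuous ival.
Proof. exact: initial_continuous. Qed.

Lemma clamp_continuous : continuous clamp.
Proof.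
apply: continuous_comp_initial => x /=.
apply: continuous_max; first exact: cst_continuous.
apply: continuous_min; first exact: cst_continuous.
exact: cvg_id.
Qed.

Lemma clamp01_neq : clamp 0 != clamp 1.
Proof.
apply/eqP => /(congr1 ival).
by rewrite !clampK ?lexx ?ler01// => /eqP; rewrite eq_sym oner_eq0.
Qed.

HB.instance Definition _ := isBiPointed.Build I clamp01_neq.

End UnitInterval.

Section Homotopy.
Context (R : realType).
Local Notation I := (unit_interval R).

Lemma pasting (Z T : topologicalType) (h : Z -> R) (c : R) (f g : Z -> T) :
  continuous h -> continuous f -> continuous g ->
  (forall z, h z = c -> f z = g z) ->
  continuous (fun z => if h z <= c then f z else g z).
Proof.
move=> ch cf cg fg.
have E : [set z | h z <= c] `|` [set z | c <= h z] = setT.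
  by apply/seteqP; split=> // z _ /=; case: (leP (h z) c) => [|/ltW]; [left|right].
apply/continuous_subspace_setT; rewrite -E; apply: withinU_continuous.
- exact: (preimage_closed (fun z _ => ch z) (@closed_le R c)).
- exact: (preimage_closed (fun z _ => ch z) (@closed_ge R c)).
- apply: (@subspace_eq_continuous _ _ _ f).
    by move=> z /set_mem hz; rewrite /from_subspace /= ifT.
  exact: continuous_subspaceT.
- apply: (@subspace_eq_continuous _ _ _ g).
    move=> z /set_mem cz; rewrite /from_subspace /=; case: ifP => // zc.
    by rewrite fg//; apply/eqP; rewrite eq_le zc cz.
  exact: continuous_subspaceT.
Qed.

Definition path_homotopic (T : topologicalType) (x y : T)
    (p q : {path I from x to y in T}) : Prop :=
  exists H : I * I -> T,
    [/\ continuous H,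
        forall t, H (zero, t) = p t,
        forall t, H (one, t) = q t
      & forall s, H (s, zero) = x /\ H (s, one) = y].

Lemma ival0 : ival (zero : I) = 0. Proof. by rewrite clampK ?lexx ?ler01. Qed.
Lemma ival1 : ival (one : I) = 1. Proof. by rewrite clampK ?lexx ?ler01. Qed.

Lemma clamp_comp_continuous (Z : topologicalType) (f : Z -> R) :
  continuous f -> continuous (fun z => clamp (f z)).
Proof. by move=> cf z; apply: (@continuous_comp _ _ _ f); [exact: cf|exact: clamp_continuous]. Qed.

Lemma comp_continuous (Z Y T : topologicalType) (g : Y -> T) (f : Z -> Y) :
  continuous g -> continuous f -> continuous (fun z => g (f z)).
Proof. by move=> cg cf z; apply: (@continuous_comp _ _ _ f g); [exact: cf|exact: cg]. Qed.

Lemma pair_continuous (Z Y T : topologicalType) (f : Z -> Y) (g : Z -> T) :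
  continuous f -> continuous g -> continuous (fun z => (f z, g z)).
Proof. by move=> cf cg z; apply: cvg_pair; [exact: cf|exact: cg]. Qed.

Lemma fst_continuous (Z Y : topologicalType) : continuous (@fst Z Y).
Proof. by move=> z; exact: cvg_fst. Qed.

Lemma snd_continuous (Z Y : topologicalType) : continuous (@snd Z Y).
Proof. by move=> z; exact: cvg_snd. Qed.

Lemma ival_fst_continuous : continuous (fun z : I * I => ival z.1).
Proof.
by apply: comp_continuous; [exact: ival_continuous|exact: fst_continuous].
Qed.

Lemma ival_snd_continuous : continuous (fun z : I * I => ival z.2).
Proof.
by apply: comp_continuous; [exact: ival_continuous|exact: snd_continuous].
Qed.

Lemma add_continuous (Z : topologicalType) (f g : Z -> R) :
  continuous f -> continuous g -> continuous (fun z => f z + g z).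
Proof. by move=> cf cg z; apply: cvgD; [exact: cf|exact: cg]. Qed.

Lemma mul_continuous (Z : topologicalType) (f g : Z -> R) :
  continuous f -> continuous g -> continuous (fun z => f z * g z).
Proof. by move=> cf cg z; apply: cvgM; [exact: cf|exact: cg]. Qed.

Lemma opp_continuous (Z : topologicalType) (f : Z -> R) :
  continuous f -> continuous (fun z => - f z).
Proof. by move=> cf z; apply: cvgN; exact: cf. Qed.

Local Ltac cts := do ?[exact: cst_continuous | exact: ival_continuous
  | exact: ival_fst_continuous | exact: ival_snd_continuous
  | exact: fst_continuous | exact: snd_continuous | assumption
  | apply: add_continuous | apply: mul_continuous | apply: opp_continuous
  | apply: clamp_comp_continuous | apply: pair_continuous].

Lemma path_continuous (T : topologicalType) (x y : T)
  (p : {path I from x to y in T}) : continuous p.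
Proof. exact: cts_fun. Qed.


Lemma path_homotopic_refl (T : topologicalType) (x y : T)
  (p : {path I from x to y in T}) : path_homotopic p p.
Proof.
exists (fun z => p z.2); split=> //.
  by apply: comp_continuous; [exact: path_continuous|exact: snd_continuous].
by move=> s /=; rewrite path_zero path_one.
Qed.

Lemma path_homotopic_sym (T : topologicalType) (x y : T)
  (p q : {path I from x to y in T}) : path_homotopic p q -> path_homotopic q p.
Proof.
move=> [H [cH H0 H1 Hs]].
exists (fun z => H (clamp (1 - ival z.1), z.2)); split=> [|t|t|s] /=.
- by apply: (comp_continuous cH); cts.
- by rewrite ival0 subr0.
- by rewrite ival1 subrr.
- exact: Hs.
Qed.

Lemma path_homotopic_trans (T : topologicalType) (x y : T)
  (p q r : {path I from x to y in T}) :
  path_homotopic p q -> path_homotopic q r -> path_homotopic p r.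
Proof.
move=> [H [cH H0 H1 Hs]] [K [cK K0 K1 Ks]].
exists (fun z : I * I => if ival z.1 <= 2^-1
  then H (clamp (2 * ival z.1), z.2) else K (clamp (2 * ival z.1 - 1), z.2)).
split=> [|t|t|s] /=.
- apply: (pasting (h := fun z : I * I => ival z.1)).
  + by cts.
  + by apply: (comp_continuous cH); cts.
  + by apply: (comp_continuous cK); cts.
  + by move=> z ->; rewrite mulfV ?pnatr_eq0// subrr H1 K0.
- by rewrite ival0 invr_ge0 ler0n mulr0 H0.
- by rewrite ival1 ifF; [rewrite (_ : 2 * 1 - 1 = 1 :> R) ?K1//; lra|lra].
- by case: ifP => _; [exact: Hs|exact: Ks].
Qed.

(* Any two reparametrizations of a path with the same endpoints are homotopic. *)
Lemma path_homotopic_reparam (T : topologicalType) (x y u v : T)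
    (p : {path I from x to y in T}) (a b : I -> R)
    (q r : {path I from u to v in T}) :
  continuous a -> continuous b ->
  a zero = b zero -> a one = b one ->
  (forall t, q t = p (clamp (a t))) -> (forall t, r t = p (clamp (b t))) ->
  path_homotopic q r.
Proof.
move=> ca cb ab0 ab1 qa rb.
exists (fun z => p (clamp ((1 - ival z.1) * a z.2 + ival z.1 * b z.2))).
have ca2 : continuous (fun z : I * I => a z.2).
  by apply: (comp_continuous ca); exact: snd_continuous.
have cb2 : continuous (fun z : I * I => b z.2).
  by apply: (comp_continuous cb); exact: snd_continuous.
split=> [|t|t|s] /=.
- apply: (comp_continuous (@path_continuous _ _ _ p)).
  by cts.
- by rewrite ival0 subr0 mul1r mul0r addr0 qa.
- by rewrite ival1 subrr mul1r mul0r add0r rb.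
- rewrite ab0 ab1 -!mulrDl subrK !mul1r -!rb.
  by rewrite path_zero path_one.
Qed.

Section Concat.
Context (T : topologicalType) (x y z : T).
Context (p : {path I from x to y in T}) (q : {path I from y to z in T}).

Definition concat_fun (t : I) : T :=
  if ival t <= 2^-1 then p (clamp (2 * ival t)) else q (clamp (2 * ival t - 1)).

Lemma concat_fun_continuous : continuous concat_fun.
Proof.
apply: pasting; first exact: ival_continuous.
- apply: (comp_continuous (@path_continuous _ _ _ p)).
  by cts.
- by apply: (comp_continuous (@path_continuous _ _ _ q)); cts.
- by move=> t ->; rewrite mulfV ?pnatr_eq0// subrr path_zero path_one.
Qed.

Lemma concat_fun0 : concat_fun zero = x.
Proof. by rewrite /concat_fun ival0 invr_ge0 ler0n mulr0 path_zero. Qed.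

Lemma concat_fun1 : concat_fun one = z.
Proof.
rewrite /concat_fun ival1 ifF; last by lra.
by rewrite (_ : 2 * 1 - 1 = 1 :> R) ?path_one//; lra.
Qed.

Definition path_concat : {path I from x to z in T} :=
  mk_path concat_fun_continuous concat_fun0 concat_fun1.

Lemma path_concat_clampl (r : R) :
  0 <= r <= 2^-1 -> path_concat (clamp r) = p (clamp (2 * r)).
Proof.
by move=> r2; rewrite /= /mk_path /concat_fun clampK; [rewrite ifT//; lra|lra].
Qed.

Lemma path_concat_clampr (r : R) :
  2^-1 < r <= 1 -> path_concat (clamp r) = q (clamp (2 * r - 1)).
Proof.
by move=> r2; rewrite /= /mk_path /concat_fun clampK; [rewrite ifF//; lra|lra].
Qed.

End Concat.

Section Reverse.
Context (T : topologicalType) (x y : T) (p : {path I from x to y in T}).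

Definition reverse_fun (t : I) : T := p (clamp (1 - ival t)).

Lemma reverse_fun_continuous : continuous reverse_fun.
Proof.
by apply: (comp_continuous (@path_continuous _ _ _ p)); cts.
Qed.

Lemma reverse_fun0 : reverse_fun zero = y.
Proof. by rewrite /reverse_fun ival0 subr0 path_one. Qed.

Lemma reverse_fun1 : reverse_fun one = x.
Proof. by rewrite /reverse_fun ival1 subrr path_zero. Qed.

Definition path_reverse : {path I from y to x in T} :=
  mk_path reverse_fun_continuous reverse_fun0 reverse_fun1.

End Reverse.

Definition path_const (T : topologicalType) (x : T) :
  {path I from x to x in T} := cst x.

Lemma path_concat_homotopic (T : topologicalType) (x y z : T)
    (p p' : {path I from x to y in T}) (q q' : {path I from y to z in T}) :
  path_homotopic p p' -> path_homotopic q q' ->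
  path_homotopic (path_concat p q) (path_concat p' q').
Proof.
move=> [H [cH H0 H1 Hs]] [K [cK K0 K1 Ks]].
exists (fun w : I * I => if ival w.2 <= 2^-1
  then H (w.1, clamp (2 * ival w.2)) else K (w.1, clamp (2 * ival w.2 - 1))).
split=> [|t|t|s] /=.
- apply: (pasting (h := fun w : I * I => ival w.2)).
  + by cts.
  + by apply: (comp_continuous cH); cts.
  + by apply: (comp_continuous cK); cts.
  + move=> w ->; rewrite mulfV ?pnatr_eq0// subrr.
    by have [_ ->] := Hs w.1; have [-> _] := Ks w.1.
- by rewrite /mk_path /concat_fun H0 K0.
- by rewrite /mk_path /concat_fun H1 K1.
- rewrite ival0 ival1 invr_ge0 ler0n mulr0 ifF; last by lra.
  rewrite (_ : 2 * 1 - 1 = 1 :> R); last by lra.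
  by split; [have [] := Hs s|have [] := Ks s].
Qed.

Lemma path_reverse_homotopic (T : topologicalType) (x y : T)
    (p q : {path I from x to y in T}) :
  path_homotopic p q -> path_homotopic (path_reverse p) (path_reverse q).
Proof.
move=> [H [cH H0 H1 Hs]].
exists (fun z => H (z.1, clamp (1 - ival z.2))); split=> [|t|t|s] /=.
- by apply: (comp_continuous cH); cts.
- exact: H0.
- exact: H1.
- by rewrite ival0 ival1 subr0 subrr; have [] := Hs s.
Qed.

Lemma path_concat_const (T : topologicalType) (x y : T)
  (p : {path I from x to y in T}) :
  path_homotopic (path_concat p (path_const y)) p.
Proof.
apply: (@path_homotopic_reparam _ _ _ _ _ p
  (fun t => if ival t <= 2^-1 then 2 * ival t else 1) (@ival R)).
- apply: pasting; [by cts..|].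
  by move=> t ->; rewrite mulfV ?pnatr_eq0.
- exact: ival_continuous.
- by rewrite ival0 invr_ge0 ler0n mulr0.
- by rewrite ival1 ifF//; lra.
- move=> t /=; rewrite /mk_path /concat_fun; case: ifP => // _.
  by rewrite path_one.
- by move=> t; rewrite ivalK.
Qed.

Lemma path_const_concat (T : topologicalType) (x y : T)
  (p : {path I from x to y in T}) :
  path_homotopic (path_concat (path_const x) p) p.
Proof.
apply: (@path_homotopic_reparam _ _ _ _ _ p
  (fun t => if ival t <= 2^-1 then 0 else 2 * ival t - 1) (@ival R)).
- apply: pasting; [by cts..|].
  by move=> t ->; rewrite mulfV ?pnatr_eq0// subrr.
- exact: ival_continuous.
- by rewrite ival0 invr_ge0 ler0n.
- by rewrite ival1 ifF; lra.
- move=> t /=; rewrite /mk_path /concat_fun; case: ifP => // _.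
  by rewrite path_zero.
- by move=> t; rewrite ivalK.
Qed.

Lemma path_concat_reverse (T : topologicalType) (x y : T)
  (p : {path I from x to y in T}) :
  path_homotopic (path_concat p (path_reverse p)) (path_const x).
Proof.
apply: (@path_homotopic_reparam _ _ _ _ _ p
  (fun t => if ival t <= 2^-1 then 2 * ival t else 1 - (2 * ival t - 1))
  (fun=> 0)).
- apply: pasting; [by cts..|].
  by move=> t ->; rewrite mulfV ?pnatr_eq0// subrr subr0.
- exact: cst_continuous.
- by rewrite ival0 invr_ge0 ler0n mulr0.
- by rewrite ival1 ifF; lra.
- move=> t /=; rewrite /mk_path /concat_fun; case: ifP => // /negbT.
  rewrite -ltNge => t2 /=; rewrite /mk_path /reverse_fun clampK//.
  by have := ival_le1 t; lra.
- by move=> t; rewrite path_zero.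
Qed.

Lemma path_reverse_concat (T : topologicalType) (x y : T)
  (p : {path I from x to y in T}) :
  path_homotopic (path_concat (path_reverse p) p) (path_const y).
Proof.
apply: (@path_homotopic_reparam _ _ _ _ _ p
  (fun t => if ival t <= 2^-1 then 1 - 2 * ival t else 2 * ival t - 1)
  (fun=> 1)).
- apply: pasting; [by cts..|].
  by move=> t ->; rewrite mulfV ?pnatr_eq0// subrr.
- exact: cst_continuous.
- by rewrite ival0 invr_ge0 ler0n mulr0 subr0.
- by rewrite ival1 ifF; lra.
- move=> t /=; rewrite /mk_path /concat_fun; case: ifP => // t2 /=.
  rewrite /mk_path /reverse_fun clampK//.
  by have := ival_ge0 t; move: t2; lra.
- by move=> t; rewrite path_one.
Qed.

Lemma path_concatA (T : topologicalType) (x y z w : T)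
  (p : {path I from x to y in T}) (q : {path I from y to z in T})
  (r : {path I from z to w in T}) :
  path_homotopic (path_concat p (path_concat q r))
                 (path_concat (path_concat p q) r).
Proof.
apply: path_homotopic_sym.
apply: (@path_homotopic_reparam _ _ _ _ _
  (path_concat p (path_concat q r))
  (fun t => if ival t <= 4^-1 then 2 * ival t else
            if ival t <= 2^-1 then ival t + 4^-1 else 2^-1 * ival t + 2^-1)
  (@ival R)).
- apply: pasting; [by cts|by cts| |].
    apply: pasting; [by cts..|].
    by move=> t ->; lra.
  by move=> t ->; rewrite ifT; lra.
- exact: ival_continuous.
- by rewrite ival0 invr_ge0 ler0n mulr0.
- by rewrite ival1 ifF; [rewrite ifF//; lra|lra].
- move=> t; have t0 := ival_ge0 t; have t1 := ival_le1 t.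
  rewrite -{1}[t]ivalK.
  case: (leP (ival t) 4^-1) => t4.
    by do 3?[rewrite path_concat_clampl; last by lra].
  case: (leP (ival t) 2^-1) => t2.
    rewrite path_concat_clampl; last by lra.
    rewrite path_concat_clampr; last by lra.
    rewrite path_concat_clampr; last by lra.
    rewrite path_concat_clampl; last by lra.
    by congr (q (clamp _)); lra.
  rewrite path_concat_clampr; last by lra.
  rewrite path_concat_clampr; last by lra.
  rewrite path_concat_clampr; last by lra.
  by congr (r (clamp _)); lra.
- by move=> t; rewrite ivalK.
Qed.

End Homotopy.

Section FundamentalGroup.
Context (R : realType) (X : topologicalType) (x : X).
Local Notation I := (unit_interval R).
Local Notation loop := {path I from x to x in X}.

Definition loop_equiv (p q : loop) : bool := `[< path_homotopic p q >].

Lemma loop_equiv_refl : reflexive loop_equiv.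
Proof. by move=> p; apply/asboolP; exact: path_homotopic_refl. Qed.

Lemma loop_equiv_sym : symmetric loop_equiv.
Proof.
by move=> p q; apply/asboolP/asboolP; exact: path_homotopic_sym.
Qed.

Lemma loop_equiv_trans : transitive loop_equiv.
Proof.
move=> q p r /asboolP pq /asboolP qr; apply/asboolP.
exact: path_homotopic_trans pq qr.
Qed.

Canonical loop_equiv_equiv :=
  EquivRel loop_equiv loop_equiv_refl loop_equiv_sym loop_equiv_trans.

Definition pi1 : Type := {eq_quot loop_equiv}.

HB.instance Definition _ := Choice.on pi1.

Definition loop_class (p : loop) : pi1 := \pi_({eq_quot loop_equiv}) p.
Definition loop_repr (a : pi1) : loop := repr (a : {eq_quot loop_equiv}).

Lemma loop_reprK : cancel loop_repr loop_class.
Proof. by move=> a; exact: reprK. Qed.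

Lemma loop_classP (p q : loop) :
  loop_class p = loop_class q <-> path_homotopic p q.
Proof.
split=> [/eqquotP/asboolP//|pq].
by apply/eqquotP/asboolP.
Qed.

Lemma loop_reprP (p : loop) : path_homotopic (loop_repr (loop_class p)) p.
Proof. by apply/loop_classP; rewrite loop_reprK. Qed.

Definition pi1_mul (a b : pi1) : pi1 :=
  loop_class (path_concat (loop_repr a) (loop_repr b)).
Definition pi1_one : pi1 := loop_class (path_const R x).
Definition pi1_inv (a : pi1) : pi1 := loop_class (path_reverse (loop_repr a)).

Lemma pi1_mul_class (p q : loop) :
  pi1_mul (loop_class p) (loop_class q) = loop_class (path_concat p q).
Proof. by apply/loop_classP/path_concat_homotopic; exact: loop_reprP. Qed.

Lemma pi1_inv_class (p : loop) :
  pi1_inv (loop_class p) = loop_class (path_reverse p).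
Proof. by apply/loop_classP/path_reverse_homotopic; exact: loop_reprP. Qed.

Lemma pi1_mulA : associative pi1_mul.
Proof.
move=> a b c; rewrite -[a]loop_reprK -[b]loop_reprK -[c]loop_reprK.
by rewrite !pi1_mul_class; apply/loop_classP; exact: path_concatA.
Qed.

Lemma pi1_mul1g : left_id pi1_one pi1_mul.
Proof.
move=> a; rewrite -[a]loop_reprK pi1_mul_class; apply/loop_classP.
exact: path_const_concat.
Qed.

Lemma pi1_mulg1 : right_id pi1_one pi1_mul.
Proof.
move=> a; rewrite -[a]loop_reprK pi1_mul_class; apply/loop_classP.
exact: path_concat_const.
Qed.

Lemma pi1_mulVg : left_inverse pi1_one pi1_inv pi1_mul.
Proof.
move=> a; rewrite -[a]loop_reprK pi1_inv_class pi1_mul_class.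
by apply/loop_classP; exact: path_reverse_concat.
Qed.

Lemma pi1_mulgV : right_inverse pi1_one pi1_inv pi1_mul.
Proof.
move=> a; rewrite -[a]loop_reprK pi1_inv_class pi1_mul_class.
by apply/loop_classP; exact: path_concat_reverse.
Qed.

HB.instance Definition _ :=
  isGroup.Build pi1 pi1_mulA pi1_mul1g pi1_mulg1 pi1_mulVg pi1_mulgV.

End FundamentalGroup.

Definition path_connected (R : realType) (X : topologicalType) : Prop :=
  forall x y : X, inhabited {path (unit_interval R) from x to y in X}.

(* The empty space counts as path connected, hence as simply connected. *)
Definition simply_connected (R : realType) (X : topologicalType) : Prop :=
  path_connected R X /\ forall (x : X) (a : pi1 R x), a = 1%g.

(* Not every [v : V] need be a vertex: the vertices are those [v] for which
   [[set v]] is a simplex. *)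
Record simplicial_complex (V : Type) := SimplicialComplex {
  simplex : set (set V);
  simplex_finite : forall s, simplex s -> finite_set s;
  simplex_neq0 : forall s, simplex s -> s !=set0;
  simplex_face : forall s t, simplex s -> t `<=` s -> t !=set0 -> simplex t
}.

(* A point of the geometric realization, in barycentric coordinates. *)
Record realization (R : realType) (V : choiceType) (K : simplicial_complex V) :=
  Realization {
  bary : V -> R;
  bary_ge0 : forall v, 0 <= bary v;
  bary_simplex : simplex K [set v | bary v != 0];
  bary_sum : \sum_(v \in [set v | bary v != 0]) bary v = 1
}.

Section RealizationTopology.
Context (R : realType) (V : choiceType) (K : simplicial_complex V).
Local Notation RK := (realization R K).

HB.instance Definition _ := gen_eqMixin RK.
HB.instance Definition _ := gen_choiceMixin RK.

Definition closed_simplex (s : set V) : set RK :=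
  [set f | [set v | bary f v != 0] `<=` s].

(* The weak topology: a set is open when its trace on each closed simplex is
   open for the Euclidean topology of that simplex, which is the one induced by
   the product topology on the barycentric coordinates. *)
Definition realization_open (A : set RK) : Prop :=
  forall s, simplex K s -> exists2 W : set {ptws V -> R},
    open W & A `&` closed_simplex s = @bary R V K @^-1` W `&` closed_simplex s.

Lemma realization_openT : realization_open setT.
Proof. by move=> s _; exists setT; [exact: openT|rewrite preimage_setT]. Qed.

Lemma realization_openI : setI_closed realization_open.
Proof.
move=> A B oA oB s Ks; have [W oW AW] := oA s Ks; have [W' oW' BW] := oB s Ks.
exists (W `&` W'); first exact: openI.
by rewrite preimage_setI setIIl AW BW -setIIl.
Qed.

Lemma realization_open_bigU (J : Type) (F : J -> set RK) :
  (forall i, realization_open (F i)) -> realization_open (\bigcup_i F i).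
Proof.
move=> oF s Ks; have /choice[W oW] : forall i, exists W : set {ptws V -> R},
    open W /\ F i `&` closed_simplex s =
      @bary R V K @^-1` W `&` closed_simplex s.
  by move=> i; have [W oW FW] := oF i s Ks; exists W.
exists (\bigcup_i W i); first by apply: bigcup_open => i _; have [] := oW i.
rewrite preimage_bigcup !setI_bigcupl; apply: eq_bigcupr => i _.
by have [] := oW i.
Qed.

HB.instance Definition _ := isOpenTopological.Build RK
  realization_openT realization_openI realization_open_bigU.

Section Vertex.
Context (v : V) (Kv : simplex K [set v]).

Let coord (w : V) : R := (w == v)%:R.

Let supp_coord : [set w | coord w != 0] = [set v].
Proof.
apply/seteqP; split=> w /=; rewrite /coord.
  by case: (w =P v) => // _ /eqP[].
by move=> ->; rewrite eqxx mulr1n oner_neq0.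
Qed.

Lemma vertex_ge0 w : 0 <= coord w. Proof. exact: ler0n. Qed.

Lemma vertex_simplex : simplex K [set w | coord w != 0].
Proof. by rewrite supp_coord. Qed.

Lemma vertex_sum : \sum_(w \in [set w | coord w != 0]) coord w = 1.
Proof. by rewrite supp_coord fsbig_set1 /coord eqxx. Qed.

Definition vertex : RK := Realization vertex_ge0 vertex_simplex vertex_sum.

End Vertex.
End RealizationTopology.

Section Nerve.
Context (X : Type) (U : set (set X)).

Definition nerve_simplex : set (set (set X)) := [set F |
  [/\ finite_set F, F !=set0, F `<=` U & \bigcap_(A in F) A !=set0]].

Lemma nerve_finite F : nerve_simplex F -> finite_set F.
Proof. by case. Qed.

Lemma nerve_neq0 F : nerve_simplex F -> F !=set0.
Proof. by case. Qed.

Lemma nerve_face F G :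
  nerve_simplex F -> G `<=` F -> G !=set0 -> nerve_simplex G.
Proof.
move=> [finF _ FU [x Fx]] GF G0; split=> //.
- exact: sub_finite_set finF.
- exact: subset_trans FU.
- by exists x => A /GF; exact: Fx.
Qed.

Definition nerve : simplicial_complex (set X) :=
  SimplicialComplex nerve_finite nerve_neq0 nerve_face.

Lemma nerve_vertex (A : set X) (x : X) : U A -> A x -> simplex nerve [set A].
Proof.
move=> UA Ax; split; [exact: finite_set1|by exists A|by move=> _ ->|].
by exists x => _ ->.
Qed.

End Nerve.

(* The intersection of the empty family, i.e. the whole space, is not required
   to belong to [U]; neither is an empty intersection. *)
Definition nonempty_setI_closed (X : Type) (U : set (set X)) : Prop :=
  forall F : set (set X), finite_set F -> F !=set0 -> F `<=` U ->
    \bigcap_(A in F) A !=set0 -> U (\bigcap_(A in F) A).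

(* Main.v *)
From HB Require Import structures.
From Corelib Require Setoid Morphisms.
Require Import Defs.
From mathcomp Require Import all_boot all_order all_algebra.
From mathcomp Require Import all_classical all_reals all_analysis.
From mathcomp Require Import homotopy ring lra.
Import Defs.

(** The group of the space and the group of the nerve are compared through a
    correspondence instead of a map.  Let [peak_at x f] mean that every vertex
    [A] at which the barycentric coordinates of the point [f] of the nerve
    attain their maximum contains [x].  Three facts about this relation carry
    the proof.

    - It is open in the product ([peak_at_open]).  Near [f] no new vertex can
      become maximal, since on each closed simplex being strictly below the
      maximum is an open condition on finitely many coordinates; and the
      finitely many maximal vertices of [f] are open sets.
    - The points [x] related to a fixed [f] form a nonempty finite
      intersection of members of the cover.  This is a member of the cover,
      hence simply connected ([peak_at_fiber_space]): this is where closure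
      under intersections is used.
    - The points [f] related to a fixed [x] can be contracted to any vertex
      [A0] containing [x]: first fade out the coordinates at the sets that
      miss [x], then transfer all the weight to [A0]
      ([peak_at_fiber_nerve]).

    An open relation [E] between two spaces whose fibers on both sides are
    nonempty and simply connected induces an isomorphism of fundamental groups
    ([pi1_correspondence]).  Say that paths [p] and [q] are related when
    [E (p t) (q t)] for all [t].  Every path has a related partner up to
    homotopy ([lift_path]), and the partners of homotopic paths are homotopic
    ([homotopic_lifts]); both statements are obtained from local ones along an
    interval ([real_induction]), the local ones being consequences of the
    openness of [E] and the simple connectedness of its fibers.  So being
    related is the graph of a bijection between homotopy classes of loops, and
    it is compatible with concatenation.

    The topology of the nerve enters through two facts: a path in a
    simplicial complex meets only finitely many open simplices
    ([path_finite_support]), and a map whose values have their supports in one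
    finite set of vertices is continuous as soon as its barycentric
    coordinates are ([realization_continuous]). *)

Set Implicit Arguments.
Unset Strict Implicit.
Unset Printing Implicit Defensive.

Import Order.TTheory GRing.Theory Num.Theory.
Import numFieldNormedType.Exports.

Local Open Scope ring_scope.
Local Open Scope classical_set_scope.

Local Notation "p ~h q" := (path_homotopic p q) (at level 70).
Local Notation "p • q" := (path_concat p q) (at level 40, left associativity).

(** * Homotopies between paths *)

#[local] Instance path_homotopic_equivalence (R : realType)
    (T : topologicalType) (x y : T) :
  RelationClasses.Equivalence (@path_homotopic R T x y).
Proof.
split=> [p|p q|p q r]; [exact: path_homotopic_refl|exact: path_homotopic_sym|].
exact: path_homotopic_trans.
Qed.

#[local] Instance path_concat_proper (R : realType) (T : topologicalType)
    (x y z : T) :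
  Morphisms.Proper (Morphisms.respectful (@path_homotopic R T x y)
    (Morphisms.respectful (@path_homotopic R T y z) (@path_homotopic R T x z)))
    (@path_concat R T x y z).
Proof. by move=> p p' pp q q' qq; exact: path_concat_homotopic. Qed.

Local Ltac cts := repeat first [assumption | match goal with
  | |- forall x, continuous_at x (fun _ => (_, _)) => apply: pair_continuous
  | |- forall x, continuous_at x (fun _ => clamp _) =>
      apply: clamp_comp_continuous
  | |- forall x, continuous_at x (fun _ => _ + _) => apply: add_continuous
  | |- forall x, continuous_at x (fun _ => _ * _) => apply: mul_continuous
  | |- forall x, continuous_at x (fun _ => - _) => apply: opp_continuous
  | |- forall x, continuous_at x (fun z => ival z.1) =>
      exact: ival_fst_continuous
  | |- forall x, continuous_at x (fun z => ival z.2) =>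
      exact: ival_snd_continuous
  | |- forall x, continuous_at x (fun z => ival z) => exact: ival_continuous
  | |- forall x, continuous_at x (fun z => z.1) => exact: fst_continuous
  | |- forall x, continuous_at x (fun z => z.2) => exact: snd_continuous
  | |- forall x, continuous_at x (fun z => z) =>
      by move=> ?; exact: cvg_id
  | |- forall x, continuous_at x (fun _ => ?c) => exact: cst_continuous
  | |- forall x, continuous_at x fst => exact: fst_continuous
  | |- forall x, continuous_at x snd => exact: snd_continuous
  | |- forall x, continuous_at x (@clamp _) => exact: clamp_continuous
  | |- forall x, continuous_at x (@ival _) => exact: ival_continuous
  end].

Section PlaneHomotopy.
Context (R : realType) (T : topologicalType).
Local Notation I := (unit_interval R).

(** The plane is convex, so two curves in it with the same endpoints are
    homotopic along straight segments.  Every reparametrization and every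
    filling of a square below is an instance. *)
Lemma path_homotopic_plane (P : R * R -> T) (a1 a2 b1 b2 : I -> R) (x y : T)
    (p q : {path I from x to y in T}) :
  continuous P -> continuous a1 -> continuous a2 ->
  continuous b1 -> continuous b2 ->
  (a1 zero, a2 zero) = (b1 zero, b2 zero) ->
  (a1 one, a2 one) = (b1 one, b2 one) ->
  (forall t, p t = P (a1 t, a2 t)) -> (forall t, q t = P (b1 t, b2 t)) ->
  p ~h q.
Proof.
move=> cP ca1 ca2 cb1 cb2 [ab10 ab20] [ab11 ab21] pa qb.
have c2 (f : I -> R) : continuous f -> continuous (fun z : I * I => f z.2).
  by move=> cf; apply: (comp_continuous cf); exact: snd_continuous.
exists (fun z => P ((1 - ival z.1) * a1 z.2 + ival z.1 * b1 z.2,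
                    (1 - ival z.1) * a2 z.2 + ival z.1 * b2 z.2)).
split=> [|t|t|s] /=.
- have := (c2 _ ca1, c2 _ ca2, c2 _ cb1, c2 _ cb2) => -[[[? ?] ?] ?].
  by apply: (comp_continuous cP); cts.
- by rewrite ival0 subr0 !mul1r !mul0r !addr0 pa.
- by rewrite ival1 subrr !mul1r !mul0r !add0r qb.
- rewrite ab10 ab20 ab11 ab21 -!mulrDl subrK !mul1r -!qb.
  by rewrite path_zero path_one.
Qed.

Lemma path_homotopic_line (P : R -> T) (a b : I -> R) (x y : T)
    (p q : {path I from x to y in T}) :
  continuous P -> continuous a -> continuous b ->
  a zero = b zero -> a one = b one ->
  (forall t, p t = P (a t)) -> (forall t, q t = P (b t)) -> p ~h q.
Proof.
move=> cP ca cb ab0 ab1 pa qb.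
apply: (@path_homotopic_plane (P \o fst) a (fun=> 0) b (fun=> 0)) => //; cts.
- by apply: comp_continuous => //; exact: fst_continuous.
- by rewrite ab0.
- by rewrite ab1.
Qed.

Section Segment.
Context (P : R -> T) (cP : continuous P).

Lemma seg_continuous (s t : R) : continuous (fun u : I => P (s + ival u * (t - s))).
Proof. by apply: (comp_continuous cP); cts. Qed.

Lemma seg_zero (s t : R) x : P s = x -> P (s + ival (zero : I) * (t - s)) = x.
Proof. by move=> <-; rewrite ival0 mul0r addr0. Qed.

Lemma seg_one (s t : R) y : P t = y -> P (s + ival (one : I) * (t - s)) = y.
Proof. by move=> <-; rewrite ival1 mul1r addrC subrK. Qed.

(** The restriction of [P] to the interval from [s] to [t], traversed backwards
    when [t < s].  The endpoints are passed through equations because they are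
    often known under other names than [P s] and [P t]. *)
Definition seg (s t : R) (x y : T) (sx : P s = x) (ty : P t = y) :
    {path I from x to y in T} :=
  mk_path (@seg_continuous s t) (seg_zero t sx) (seg_one s ty).

Lemma seg_concat (s t u : R) (x y z : T) (sx : P s = x) (ty : P t = y)
    (uz : P u = z) : seg sx ty • seg ty uz ~h seg sx uz.
Proof.
apply: (@path_homotopic_line P
  (fun v => if ival v <= 2^-1 then s + 2 * ival v * (t - s)
            else t + (2 * ival v - 1) * (u - t))
  (fun v => s + ival v * (u - s))) => //; cts.
- apply: pasting; [exact: ival_continuous|by cts|by cts|].
  by move=> v ->; lra.
- by rewrite ival0 ifT; lra.
- by rewrite ival1 ifF; lra.
- move=> v; have v0 := ival_ge0 v; have v1 := ival_le1 v.
  rewrite -[in LHS](ivalK v); case: ifP => v2.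
    by rewrite path_concat_clampl ?v0//= /mk_path clampK//; lra.
  rewrite path_concat_clampr/= /mk_path ?clampK//; try lra.
Qed.

Lemma seg_nil (s : R) (x : T) (sx sx' : P s = x) : seg sx sx' ~h path_const R x.
Proof.
apply: (@path_homotopic_line P (fun=> s) (fun=> s)) => //; cts.
by move=> v /=; rewrite /mk_path subrr mulr0 addr0.
Qed.

End Segment.

(** Both sides are images of curves from one corner of the square to the
    opposite one. *)
Lemma path_homotopic_square (H : I * I -> T) (a b c d : T)
    (p : {path I from a to b in T}) (q : {path I from c to d in T})
    (l : {path I from a to c in T}) (r : {path I from b to d in T}) :
  continuous H -> (forall t, H (zero, t) = p t) -> (forall t, H (one, t) = q t) ->
  (forall s, H (s, zero) = l s) -> (forall s, H (s, one) = r s) ->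
  l • q ~h p • r.
Proof.
move=> cH Hp Hq Hl Hr.
apply: (@path_homotopic_plane (fun z => H (clamp z.1, clamp z.2))
  (fun v => if ival v <= 2^-1 then 2 * ival v else 1)
  (fun v => if ival v <= 2^-1 then 0 else 2 * ival v - 1)
  (fun v => if ival v <= 2^-1 then 0 else 2 * ival v - 1)
  (fun v => if ival v <= 2^-1 then 2 * ival v else 1)).
- by apply: (comp_continuous cH); cts.
- by apply: pasting; [by cts..|move=> ? ->; lra].
- by apply: pasting; [by cts..|move=> ? ->; lra].
- by apply: pasting; [by cts..|move=> ? ->; lra].
- by apply: pasting; [by cts..|move=> ? ->; lra].
- by rewrite ival0 invr_ge0 ler0n mulr0.
- rewrite ival1 (_ : (1 <= 2^-1 :> R) = false); last by lra.
  by congr pair; lra.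
- move=> v /=; rewrite /mk_path /concat_fun.
  by case: ifP => _ /=; [exact: esym (Hl _)|exact: esym (Hq _)].
- move=> v /=; rewrite /mk_path /concat_fun.
  by case: ifP => _ /=; [exact: esym (Hp _)|exact: esym (Hr _)].
Qed.

End PlaneHomotopy.

(** * Induction along an interval, and the tube lemma *)
Section RealInduction.
Context (R : realType).

(** The supremum of the points up to which [S] holds cannot lie strictly inside
    the interval: the local hypothesis pushes [S] past it. *)
Lemma real_induction (S : R -> Prop) :
  S 0 ->
  (forall t0, 0 <= t0 <= 1 -> exists2 e, 0 < e & forall t t', 0 <= t <= t' ->
     t' <= 1 -> `|t - t0| < e -> `|t' - t0| < e -> S t -> S t') ->
  S 1.
Proof.
move=> S0 Sloc; pose B := [set t : R | 0 <= t <= 1 /\ forall u, 0 <= u <= t -> S u].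
have B0 : B 0.
  split=> [|u]; first by rewrite lexx ler01.
  by move=> u0; have -> : u = 0 by lra.
have supB : has_sup B by split; [exists 0|exists 1 => t -[/andP[]]].
have sup0 : 0 <= sup B by exact: sup_upper_bound.
have sup1 : sup B <= 1.
  by apply: sup_le_ub; [exists 0|move=> t -[/andP[]]].
have [|e e0 He] := Sloc (sup B); first by rewrite sup0 sup1.
have [t [t01 Bt] tsup] := sup_adherent e0 supB.
have tle : t <= sup B by exact: sup_upper_bound.
have SB u : 0 <= u <= 1 -> u <= sup B + e / 2 -> S u.
  move=> u01 ue; case: (lerP u t) => ut; first by apply: Bt; lra.
  apply: (He t u); [by lra|by lra|..|by apply: Bt; lra].
    by rewrite ltr_norml; lra.
  by rewrite ltr_norml; lra.
case: (lerP 1 (sup B + e / 2)) => s1; first by apply: SB; lra.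
suff : sup B + e / 2 <= sup B by lra.
apply: sup_upper_bound => //; split=> [|u ?]; first by lra.
by apply: SB; lra.
Qed.

Lemma tube (J : topologicalType) (G : J -> R -> Prop) (j0 : J) :
  (forall t : R, 0 <= t <= 1 -> \forall j \near j0 & t' \near t, G j t') ->
  \forall j \near j0, forall t, 0 <= t <= 1 -> G j t.
Proof.
move=> Gloc; have /compact_near_coveringP := @segment_compact R 0 1.
move=> /(_ J (nbhs j0) G _) cov; apply: filterS (cov _) => [j sub t t01|t].
  by apply: sub; rewrite /= in_itv.
rewrite /= in_itv /= => /Gloc [[A B] /= [nA nB] AB].
by exists (B, A) => // -[u j] /= [Bu Aj]; exact: (AB (j, u)).
Qed.

Lemma ball_segment (t0 e s t : R) (u : unit_interval R) :
  `|s - t0| < e -> `|t - t0| < e -> `|s + ival u * (t - s) - t0| < e.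
Proof.
have u0 := ival_ge0 u; have u1 : 0 <= 1 - ival u by rewrite subr_ge0 ival_le1.
move=> se te; have -> : s + ival u * (t - s) - t0 =
  (1 - ival u) * (s - t0) + ival u * (t - t0) by ring.
pose m := Num.max `|s - t0| `|t - t0|.
have me : m < e by rewrite gt_max se te.
apply: le_lt_trans me; apply: le_trans (ler_normD _ _) _.
rewrite !normrM (ger0_norm u0) (ger0_norm u1).
have -> : m = (1 - ival u) * m + ival u * m by ring.
by rewrite lerD// ler_wpM2l// le_max lexx ?orbT.
Qed.

Lemma clamp_ge1 (t : R) : 1 <= t -> clamp t = one :> unit_interval R.
Proof.
move=> t1; apply: ival_inj; rewrite ival1 /ival /clamp set_valE /=.
by rewrite (min_idPl t1) (max_idPr ler01).
Qed.

End RealInduction.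

Section ConcatIn.
Context (R : realType) (Y Z : topologicalType).
Local Notation I := (unit_interval R).

Lemma path_concat_in (A : set Z) (x y z : Z) (p : {path I from x to y in Z})
    (q : {path I from y to z in Z}) :
  (forall t, A (p t)) -> (forall t, A (q t)) -> forall t, A ((p • q) t).
Proof. by move=> Ap Aq t /=; rewrite /mk_path /concat_fun; case: ifP. Qed.

Lemma path_concat_in2 (E : Y -> Z -> Prop) (a b c : Y) (x y z : Z)
    (p : {path I from a to b in Y}) (p' : {path I from b to c in Y})
    (q : {path I from x to y in Z}) (q' : {path I from y to z in Z}) :
  (forall t, E (p t) (q t)) -> (forall t, E (p' t) (q' t)) ->
  forall t, E ((p • p') t) ((q • q') t).
Proof. by move=> Eq Eq' t /=; rewrite /mk_path /concat_fun; case: ifP. Qed.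

End ConcatIn.

(** * Simply connected subsets *)

Section SimplyConnectedSubsets.
Context (R : realType).
Local Notation I := (unit_interval R).

(** Paths in [A] are only required to be homotopic in the ambient space, which
    is all that the lifting argument uses. *)
Definition simply_connected_in (T : topologicalType) (A : set T) : Prop :=
  (forall x y, A x -> A y ->
     exists p : {path I from x to y in T}, forall t, A (p t)) /\
  (forall x y (p q : {path I from x to y in T}),
     (forall t, A (p t)) -> (forall t, A (q t)) -> p ~h q).

Lemma path_homotopic_comp (S T : topologicalType) (f : S -> T) (x y : S)
    (x' y' : T) (p q : {path I from x to y in S})
    (p' q' : {path I from x' to y' in T}) :
  continuous f -> (forall t, f (p t) = p' t) -> (forall t, f (q t) = q' t) ->
  p ~h q -> p' ~h q'.
Proof.
move=> cf fp fq [H [cH H0 H1 Hs]]; exists (fun w => f (H w)); split=> [|t|t|s].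
- exact: (comp_continuous cf).
- by rewrite H0 fp.
- by rewrite H1 fq.
- have [-> ->] := Hs s.
  by have := (fp zero, fp one); rewrite !path_zero !path_one => -[].
Qed.

Lemma simply_connected_subspace (T : topologicalType) (A : set T) :
  simply_connected R (set_type A) -> simply_connected_in A.
Proof.
move=> [Aconn Asimp].
have cval : continuous (set_val : set_type A -> T) by exact: initial_continuous.
split=> [x y Ax Ay|x y p q Ap Aq].
  have [p] := Aconn (exist (fun r => r \in A) x (mem_set Ax))
    (exist (fun r => r \in A) y (mem_set Ay)).
  have cp : continuous (fun t => set_val (p t) : T).
    by apply: (comp_continuous cval); exact: path_continuous.
  have p0 : set_val (p zero) = x by rewrite path_zero set_valE.
  have p1 : set_val (p one) = y by rewrite path_one set_valE.
  exists (mk_path cp p0 p1) => t; exact: set_mem (valP (p t)).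
have Ax : A x by rewrite -(path_zero (s := p)).
have Ay : A y by rewrite -(path_one (s := p)).
pose x' : set_type A := exist (fun r => r \in A) x (mem_set Ax).
pose y' : set_type A := exist (fun r => r \in A) y (mem_set Ay).
have restr (r : {path I from x to y in T}) : (forall t, A (r t)) ->
    exists r' : {path I from x' to y' in set_type A},
      forall t, set_val (r' t) = r t.
  move=> Ar; pose r' t : set_type A := exist (fun r => r \in A) (r t) (mem_set (Ar t)).
  have cr' : continuous r'.
    by apply: continuous_comp_initial; exact: path_continuous.
  have r'0 : r' zero = x' by apply: val_inj; exact: path_zero.
  have r'1 : r' one = y' by apply: val_inj; exact: path_one.
  by exists (mk_path cr' r'0 r'1).
have [p' p'E] := restr p Ap; have [q' q'E] := restr q Aq.
apply: (path_homotopic_comp cval p'E q'E).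
have /loop_classP pq := Asimp x' (loop_class (p' • path_reverse q')).
rewrite -(path_concat_const p') -(path_reverse_concat q') path_concatA pq.
exact: path_const_concat.
Qed.

(** A path [f] in [A] from [x] to [y] is the bottom side of the square
    [h s (f t)], whose top side is constant.  Hence [f] is homotopic to the
    track of [x] followed by the reversed track of [y], which does not depend
    on [f].  Continuity of [h] is only required along paths, because joint
    continuity is delicate for the weak topology of a complex. *)
Lemma simply_connected_contraction (T : topologicalType) (A : set T)
    (h : I -> T -> T) (c : T) :
  (forall x, A x -> h zero x = x) -> (forall x, A x -> h one x = c) ->
  (forall s x, A x -> A (h s x)) ->
  (forall x y (p : {path I from x to y in T}), (forall t, A (p t)) ->
     continuous (fun w : I * I => h w.1 (p w.2))) ->
  simply_connected_in A.
Proof.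
move=> h0 h1 hA hc.
have htrack x (Ax : A x) :
    exists l : {path I from x to c in T}, forall s, l s = h s x.
  have cl : continuous (fun s => h s x).
    have := hc _ _ (path_const R x) (fun=> Ax).
    move=> /comp_continuous/(_ (@pair_continuous _ _ _ (fun s : I => s) (fun=> zero) _ _)).
    by apply; cts.
  by exists (mk_path cl (h0 x Ax) (h1 x Ax)).
split=> [x y Ax Ay|x y p q Ap Aq].
  have [l lE] := htrack x Ax; have [r rE] := htrack y Ay.
  exists (l • path_reverse r); apply: path_concat_in => t.
    by rewrite lE; exact: hA.
  by rewrite /= /mk_path /reverse_fun rE; exact: hA.
have Ax : A x by rewrite -(path_zero (s := p)).
have Ay : A y by rewrite -(path_one (s := p)).
have [l lE] := htrack x Ax; have [r rE] := htrack y Ay.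
have tracks (f : {path I from x to y in T}) : (forall t, A (f t)) ->
    f ~h l • path_reverse r.
  move=> Af.
  have lr : l • path_const R c ~h f • r.
    apply: (path_homotopic_square (hc _ _ f Af)) => [t|t|s|s] /=.
    - exact: h0.
    - exact: h1.
    - by rewrite path_zero lE.
    - by rewrite path_one rE.
  rewrite -(path_concat_const f) -(path_concat_reverse r) path_concatA -lr.
  by rewrite path_concat_const; reflexivity.
by rewrite (tracks _ Ap) (tracks _ Aq); reflexivity.
Qed.

End SimplyConnectedSubsets.

(** * Lifting paths through an open relation *)

Definition simply_connected_fibers (R : realType) (Y Z : topologicalType)
    (E : Y -> Z -> Prop) : Prop :=
  forall y, (exists z, E y z) /\ simply_connected_in R (E y).

Section Lifting.
Context (R : realType) (Y Z : topologicalType) (E : Y -> Z -> Prop).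
Local Notation I := (unit_interval R).
Hypothesis Eopen : open [set w : Y * Z | E w.1 w.2].
Hypothesis Efib : simply_connected_fibers R E.

Lemma open_rel_near (J K : topologicalType) (f : J -> Y) (g : K -> Z) j k :
  continuous f -> continuous g -> E (f j) (g k) ->
  \forall j' \near j & k' \near k, E (f j') (g k').
Proof.
move=> cf cg Ejk.
have [[A B] /= [nA nB] AB] : nbhs (f j, g k) [set w : Y * Z | E w.1 w.2].
  exact: open_nbhs_nbhs.
exists (f @^-1` A, g @^-1` B) => /=; first by split; [exact: cf|exact: cg].
by move=> [a b] [/= Aa Bb]; exact: (AB (f a, g b)).
Qed.

Lemma open_rel_near_path (J : topologicalType) (f : J * I -> Y) (j : J)
    (z z' : Z) (r : {path I from z to z' in Z}) :
  continuous f -> (forall t, E (f (j, t)) (r t)) ->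
  \forall j' \near j, forall t, E (f (j', t)) (r t).
Proof.
move=> cf Er.
have cf' : continuous (fun w : J * R => f (w.1, clamp w.2)).
  by apply: (comp_continuous cf); cts.
have cr : continuous (fun t : R => r (clamp t)).
  by apply: (comp_continuous (@path_continuous _ _ _ _ r)); cts.
have : \forall j' \near j, forall t : R, 0 <= t <= 1 ->
    E (f (j', clamp t)) (r (clamp t)).
  apply: tube => t t01.
  have [[A B] /= [[[A1 A2] /= [nA1 nA2] A12] nB] AB] :=
    open_rel_near cf' cr (j := (j, t)) (k := t) (Er _).
  exists (A1, A2 `&` B) => /=; first by split=> //; exact: filterI.
  move=> [j' t'] /= [A1j' [A2t' Bt']].
  by apply: (AB ((j', t'), t')); split=> //; exact: (A12 (j', t')).
apply: filterS => j' H t; rewrite -[t]ivalK; apply: H.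
by rewrite ival_ge0 ival_le1.
Qed.

Lemma open_rel_near_fiber (J : topologicalType) (f : J -> Y) (j : J)
    (z z' : Z) (r : {path I from z to z' in Z}) :
  continuous f -> (forall t, E (f j) (r t)) ->
  \forall j' \near j, forall t, E (f j') (r t).
Proof.
move=> cf; apply: (@open_rel_near_path J (fun w => f w.1)).
by apply: (comp_continuous cf); cts.
Qed.

(** A lift [Q] defined up to time [t] is extended past [t] by running quickly
    along a path in the fiber over [P t] from [Q t] to a point [d0] that is
    related to all nearby values of [P]; openness leaves the time to do so
    before [P] moves too far.  The end of the lift cannot be prescribed here. *)
Lemma exact_lift (P : R -> Y) (c : Z) : continuous P -> E (P 0) c ->
  exists Q : R -> Z,
    [/\ continuous Q, Q 0 = c & forall t, 0 <= t <= 1 -> E (P t) (Q t)].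
Proof.
have Ene y := (Efib y).1; have Econn y := (Efib y).2.1; move=> cP Ec.
pose S (s : R) := exists Q : R -> Z,
  [/\ continuous Q, Q 0 = c & forall t, 0 <= t <= s -> E (P t) (Q t)].
suff: S 1 by [].
apply: real_induction => [|t0 _].
  exists (fun=> c); split=> //; first exact: cst_continuous.
  by move=> t t0; have -> : t = 0 by lra.
have [d0 Ed0] := Ene (P t0).
have /nbhs_ballP[e /= e0 He] : \forall t \near t0, E (P t) d0.
  have := open_rel_near cP (@cst_continuous R Z d0) (j := t0) (k := t0) Ed0.
  move=> [[A B] /= [nA nB] AB]; apply: filterS nA => t At.
  by apply: (AB (t, t0)); split=> //=; exact: nbhs_singleton.
exists e => // t t' /andP[t_ge0 tt'] _ te t'e [Q [cQ Q0 EQ]].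
have Et u : t <= u <= t' -> E (P u) d0.
  move=> ?; apply: He; rewrite /ball /= ltr_norml.
  by move: te t'e; rewrite !ltr_norml; lra.
have [r Er] : exists p : {path I from Q t to d0 in Z}, forall u, E (P t) (p u).
  by apply: Econn; [apply: EQ|apply: Et]; lra.
(* The path in the fiber stays related to [P u] while [u - t < d], and it is
   run through in time [d / 2]. *)
have /nbhs_ballP[d /= d_gt0 Hd] := open_rel_near_fiber cP Er.
exists (fun u => if u <= t then Q u else r (clamp ((u - t) * (2 / d)))).
split=> [||u u01].
- apply: (pasting (h := id)) => //; first by move=> ?; exact: cvg_id.
    by apply: (comp_continuous (@path_continuous _ _ _ _ r)); cts.
  by move=> z ->; rewrite subrr mul0r path_zero.
- by rewrite t_ge0.
- case: ifP => [ut|/negbT]; first by apply: EQ; lra.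
  rewrite -ltNge => tu; case: (ltrP (u - t) d) => ud.
    apply: Hd; rewrite /ball /= distrC ger0_norm; lra.
  rewrite clamp_ge1; first by rewrite path_one; apply: Et; lra.
  by rewrite mulrA ler_pdivlMr//; lra.
Qed.

(** Waiting at the end of [p] gives the lift the time to reach the prescribed
    end [d] inside the fiber over [b]. *)
Lemma lift_path (a b : Y) (c d : Z) (p : {path I from a to b in Y}) :
  E a c -> E b d ->
  exists q : {path I from c to d in Z}, forall t, E ((p • path_const R b) t) (q t).
Proof.
have Econn y := (Efib y).2.1; move=> Eac Ebd.
have cP : continuous (fun t : R => p (clamp t)).
  by apply: (comp_continuous (@path_continuous _ _ _ _ p)); cts.
have [|Q [cQ Q0 EQ]] := exact_lift (c := c) cP; first by rewrite path_zero.
have EQ' (v : I) : E (p v) (Q (ival v)).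
  by rewrite -[v in p v]ivalK; apply: EQ; rewrite ival_ge0 ival_le1.
have [|r Er] := Econn b (Q 1) d _ Ebd.
  by have := EQ' one; rewrite path_one ival1.
exists (seg cQ Q0 erefl • r) => t /=.
rewrite /mk_path /concat_fun; case: ifP => _ //=.
by rewrite /mk_path /= subr0 mulr1 add0r.
Qed.

(** The statement that propagates along the interval is that for every path
    [r] from [q t] to [q' t] in the fiber over [p t], the path [q] up to [t]
    followed by [r] is homotopic to [q'] up to [t].  Locally one
    fixes [r0] over [p t0]; for nearby [t] the detour from [q t] back to [q t0],
    along [r0], and on to [q' t] still lies in the fiber over [p t], so by
    simple connectedness it can stand for any [r]. *)
Lemma lift_unique (a b : Y) (c d : Z) (p : {path I from a to b in Y})
    (q q' : {path I from c to d in Z}) :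
  (forall t, E (p t) (q t)) -> (forall t, E (p t) (q' t)) -> q ~h q'.
Proof.
have Econn y := (Efib y).2.1; have Esimp y := (Efib y).2.2; move=> Eq Eq'.
pose P (t : R) := p (clamp t); pose Q (t : R) := q (clamp t).
pose Q' (t : R) := q' (clamp t).
have cP : continuous P.
  by apply: (comp_continuous (@path_continuous _ _ _ _ p)); cts.
have cQ : continuous Q.
  by apply: (comp_continuous (@path_continuous _ _ _ _ q)); cts.
have cQ' : continuous Q'.
  by apply: (comp_continuous (@path_continuous _ _ _ _ q')); cts.
have Q0 : Q 0 = c by exact: path_zero.
have Q'0 : Q' 0 = c by exact: path_zero.
pose S (t : R) := forall z z' (Qt : Q t = z) (Q't : Q' t = z')
  (r : {path I from z to z' in Z}), (forall u, E (P t) (r u)) ->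
  seg cQ Q0 Qt • r ~h seg cQ' Q'0 Q't.
have : S 1.
  apply: real_induction => [z z' Qz Q'z|t0 _].
    have zc : z = c by rewrite -Qz Q0.
    have z'c : z' = c by rewrite -Q'z Q'0.
    move: Qz Q'z; rewrite zc z'c => Qz Q'z r Er.
    rewrite !seg_nil path_const_concat; apply: (Esimp (P 0)) => // u /=.
    by rewrite -Q0; exact: Eq.
  have [r0 Er0] : exists r : {path I from Q t0 to Q' t0 in Z}, forall u, E (P t0) (r u).
    by apply: Econn; [exact: Eq|exact: Eq'].
  have [e e0 He] : exists2 e : R, 0 < e & forall t t', `|t - t0| < e ->
      `|t' - t0| < e ->
      [/\ E (P t) (Q t'), E (P t) (Q' t') & forall u, E (P t) (r0 u)].
    have [[A B] /= [nA nB] AB] := open_rel_near cP cQ (Eq (clamp t0)).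
    have [[A' B'] /= [nA' nB'] AB'] := open_rel_near cP cQ' (Eq' (clamp t0)).
    have /nbhs_ballP[e e0 He] : nbhs t0 (A `&` B `&` (A' `&` B') `&`
        [set t | forall u, E (P t) (r0 u)]).
      apply: filterI; first by apply: filterI; exact: filterI.
      exact: (open_rel_near_fiber cP Er0).
    exists e => // t t' te t'e.
    have [[[At _] [A't _]] Ct] : (A `&` B `&` (A' `&` B') `&`
      [set t | forall u, E (P t) (r0 u)]) t by apply: He; rewrite /ball /= distrC.
    have [[[_ Bt'] [_ B't']] _] : (A `&` B `&` (A' `&` B') `&`
      [set t | forall u, E (P t) (r0 u)]) t' by apply: He; rewrite /ball /= distrC.
    by split; [exact: (AB (t, t'))|exact: (AB' (t, t'))|exact: Ct].
  have t0e : `|t0 - t0| < e by rewrite subrr normr0.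
  have Er0' t (te : `|t - t0| < e) z z' (Qt : Q t = z) (Q't : Q' t = z') u :
      E (P t) ((seg cQ Qt (erefl (Q t0)) • r0 • seg cQ' (erefl (Q' t0)) Q't) u).
    apply: path_concat_in => [{}u|{}u]; first apply: path_concat_in => {}u.
    - by have [] := He t _ te (ball_segment u te t0e).
    - by have [] := He t t te te.
    - by have [] := He t _ te (ball_segment u t0e te).
  exists e => // t t' tt' _ te t'e St z z' Qt' Q't' r Er.
  have -> : r ~h seg cQ Qt' (erefl (Q t0)) • r0 • seg cQ' (erefl (Q' t0)) Q't'.
    by apply: (Esimp (P t')) => //; exact: Er0'.
  rewrite -(seg_concat cQ' Q'0 (erefl (Q' t)) Q't').
  rewrite -(St _ _ erefl erefl _ (Er0' _ te _ _ erefl erefl)).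
  rewrite !path_concatA !seg_concat -[X in _ ~h X]path_concatA seg_concat.
  reflexivity.
move=> /(_ d d (@path_one _ _ _ _ q) (@path_one _ _ _ _ q') (path_const R d)).
rewrite path_concat_const.
have -> : seg cQ Q0 (@path_one _ _ _ _ q) = q.
  by apply/path_eqP => u /=; rewrite /mk_path subr0 mulr1 add0r /Q ivalK.
have -> : seg cQ' Q'0 (@path_one _ _ _ _ q') = q'.
  by apply/path_eqP => u /=; rewrite /mk_path subr0 mulr1 add0r /Q' ivalK.
by apply=> u; rewrite -[d](@path_one _ _ _ _ q); exact: Eq.
Qed.

(** By induction on the homotopy parameter [s], every lift of the path at [s]
    is homotopic to [q].  One lift [r0] of the path at [s0]
    is also a lift of all nearby paths of the homotopy, by openness and
    compactness of the interval, and lifts of a single path are homotopic.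
    All paths are followed by a constant one so that [lift_path] applies. *)
Lemma homotopic_lifts (a b : Y) (c d : Z) (p p' : {path I from a to b in Y})
    (q q' : {path I from c to d in Z}) :
  (forall t, E (p t) (q t)) -> (forall t, E (p' t) (q' t)) ->
  p ~h p' -> q ~h q'.
Proof.
move=> Eq Eq' [H [cH H0 H1 Hs]].
have Eac : E a c by rewrite -(@path_zero _ _ _ _ p) -(@path_zero _ _ _ _ q).
have Ebd : E b d by rewrite -(@path_one _ _ _ _ p) -(@path_one _ _ _ _ q).
have cHs (s : R) : continuous (fun t => H (clamp s, t)).
  apply: (comp_continuous cH).
  by apply: (@pair_continuous _ _ _ (fun=> clamp s) (fun t => t)); cts.
pose h s : {path I from a to b in Y} :=
  mk_path (@cHs s) (Hs (clamp s)).1 (Hs (clamp s)).2.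
pose S (s : R) := forall r : {path I from c to d in Z},
  (forall t, E ((h s • path_const R b) t) (r t)) -> r ~h q.
have hp : h 0 = p by apply/path_eqP => t; exact: H0.
have hp' : h 1 = p' by apply/path_eqP => t; exact: H1.
have S1 : S 1.
  apply: real_induction => [r|s0 _].
    rewrite hp => Er; rewrite -(path_concat_const q).
    by apply: lift_unique Er _; exact: path_concat_in2.
  have [r0 Er0] := lift_path (h s0) Eac Ebd.
  have /nbhs_ballP[e e0 He] : \forall s \near s0,
      forall t, E ((h s • path_const R b) t) (r0 t).
    have := @open_rel_near_path _ (fun w : R * I => if ival w.2 <= 2^-1
      then H (clamp w.1, clamp (2 * ival w.2)) else b) s0 _ _ r0.
    apply=> //; apply: (pasting (h := fun w : R * I => ival w.2)).
    - by apply: (comp_continuous (@ival_continuous R)); cts.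
    - apply: (comp_continuous cH); cts.
      by apply: (comp_continuous (@ival_continuous R)); cts.
    - by cts.
    - by move=> w ->; rewrite mulfV ?pnatr_eq0//; exact: (Hs _).2.
  exists e => // s s' _ _ se s'e Ss r Er.
  rewrite -(Ss r0); last by apply: He; rewrite /ball /= distrC.
  by apply: lift_unique Er _; apply: He; rewrite /ball /= distrC.
rewrite -(path_concat_const q'); symmetry; apply: S1.
by rewrite hp'; exact: path_concat_in2.
Qed.

End Lifting.

(** * The isomorphism induced by an open relation *)

Section Correspondence.
Context (R : realType) (Y Z : topologicalType) (E : Y -> Z -> Prop).
Local Notation I := (unit_interval R).
Hypothesis Eopen : open [set w : Y * Z | E w.1 w.2].
Hypothesis Efib : simply_connected_fibers R E.
Hypothesis Efib' : simply_connected_fibers R (fun z y => E y z).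

(** Two classes are related when they have related representatives.
    [lift_path] makes this relation total and [homotopic_lifts] makes it
    functional; the hypotheses being symmetric in [Y] and [Z], it is also
    surjective and injective. *)
Theorem pi1_correspondence (y : Y) (z : Z) : E y z ->
  exists f : {multiplicative pi1 R y -> pi1 R z}, bijective f.
Proof.
move=> Eyz.
have Eopen' : open [set w : Z * Y | E w.2 w.1].
  have -> : [set w : Z * Y | E w.2 w.1] =
      (fun w => (w.2, w.1)) @^-1` [set w : Y * Z | E w.1 w.2] by [].
  by apply: open_comp => // w _; apply: pair_continuous; cts.
pose rel (a : pi1 R y) (b : pi1 R z) := exists (p : {path I from y to y in Y})
  (q : {path I from z to z in Z}),
  [/\ loop_class p = a, loop_class q = b & forall t, E (p t) (q t)].
have rel_fun a b b' : rel a b -> rel a b' -> b = b'.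
  move=> [p [q [<- <- Epq]]] [p' [q' [/loop_classP pp' <- Epq']]].
  apply/loop_classP; symmetry.
  exact: (homotopic_lifts Eopen Efib Epq' Epq).
have rel_inj a a' b : rel a b -> rel a' b -> a = a'.
  move=> [p [q [<- <- Epq]]] [p' [q' [<- /loop_classP qq' Epq']]].
  apply/loop_classP; symmetry.
  exact: (homotopic_lifts Eopen' Efib' Epq' Epq).
have rel_tot a : exists b, rel a b.
  have [q Eq] := lift_path Eopen Efib (loop_repr a) Eyz Eyz.
  exists (loop_class q), (loop_repr a • path_const R y), q; split=> //.
  by rewrite -[RHS]loop_reprK; apply/loop_classP; exact: path_concat_const.
have rel_surj b : exists a, rel a b.
  have [p Ep] := lift_path Eopen' Efib' (loop_repr b) Eyz Eyz.
  exists (loop_class p), p, (loop_repr b • path_const R z); split=> //.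
  by rewrite -[RHS]loop_reprK; apply/loop_classP; exact: path_concat_const.
have [f fE] := choice rel_tot; have [g gE] := choice rel_surj.
have fM : {morph f : a b / (a * b)%g}.
  move=> a b; have [p [q [pa qa Epq]]] := fE a.
  have [p' [q' [pb qb Epq']]] := fE b.
  apply: (rel_fun (a * b)%g); first exact: fE.
  exists (p • p'), (q • q'); rewrite -!pi1_mul_class pa pb qa qb; split=> //.
  exact: path_concat_in2.
pose F : {multiplicative pi1 R y -> pi1 R z} :=
  HB.pack f (isMultiplicative.Build _ _ f fM).
exists F, g => [a|b]; first exact: rel_inj (gE _) (fE _).
exact: rel_fun (fE _) (gE _).
Qed.

End Correspondence.

(** * Topology of geometric realizations *)

Section Realization.
Context (R : realType) (V : choiceType) (K : simplicial_complex V).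
Local Notation I := (unit_interval R).
Local Notation RK := (realization R K).

Definition support (f : RK) : set V := [set v | bary f v != 0].

Lemma support_finite (f : RK) : finite_set (support f).
Proof. exact: simplex_finite (bary_simplex f). Qed.

Lemma open_realizationE (O : set RK) : open O = realization_open O.
Proof. by []. Qed.

Lemma bary_inj : injective (@bary R V K).
Proof.
move=> [f f0 fs f1] [g g0 gs g1] /= fg; subst g.
by congr Realization; exact: Prop_irrelevance.
Qed.

Lemma bary_continuous (v : V) : continuous (fun f : RK => bary f v).
Proof.
apply/continuousP => O oO; rewrite open_realizationE => s Ks.
exists ((fun g : {ptws V -> R} => g v) @^-1` O) => //.
by apply: open_comp => // g _; exact: (@proj_continuous V (fun=> R) v).
Qed.

Lemma ptws_continuous (J : topologicalType) (g : J -> {ptws V -> R}) :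
  (forall v, continuous (fun j => g j v)) -> continuous g.
Proof.
move=> cg j; apply/cvg_sup => v; apply/cvg_image.
  by apply/seteqP; split=> // r _; exists (fun=> r).
move=> O /cg nO; exists ((fun f : V -> R => f v) @^-1` O) => //.
by apply/seteqP; split=> [r [f fO <-]//|r Or]; exists (fun=> r).
Qed.

(** In the weak topology closedness is tested on closed simplices, and there
    finite sets are closed. *)
Lemma closed_locally_finite (D : set RK) :
  (forall s, simplex K s -> finite_set (D `&` closed_simplex s)) -> closed D.
Proof.
move=> Dfin; rewrite -[D]setCK; apply: open_closedC.
rewrite open_realizationE => s Ks.
exists (~` (@bary R V K @` (D `&` closed_simplex s))).
  apply: closed_openC.
  apply: (iffLR (@accessible_finite_set_closed {ptws V -> R})); last first.
    exact/finite_image/Dfin.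
  apply: hausdorff_accessible.
  by apply: (@hausdorff_product V (fun=> R)) => _; exact: Rhausdorff.
apply/seteqP; split=> f [nD sf]; split=> //.
  by move=> [g [Dg _] /bary_inj gf]; apply: nD; rewrite -gf.
by move=> Df; apply: nD; exists f.
Qed.

(** Choose for each vertex [v] occurring along the path a point of the path
    whose support contains [v].  A closed simplex contains the points chosen
    for its own finitely many vertices only, so every set of chosen points is
    closed.  The set of chosen points is thus closed and discrete, and a
    compact path meets it in a finite set. *)
Lemma path_finite_support (f g : RK) (p : {path I from f to g in RK}) :
  exists l : seq V, forall t, support (p t) `<=` [set` l].
Proof.
pose V0 := \bigcup_t support (p t).
have /choice[T TE] : forall v, exists t, V0 v -> support (p t) v.
  move=> v; case: (pselect (V0 v)) => [[t _ ptv]|nv]; first by exists t.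
  by exists zero.
pose C := [set p (T v) | v in V0].
have Cclosed D : D `<=` C -> closed D.
  move=> DC; apply: closed_locally_finite => s Ks.
  apply: (@sub_finite_set _ _ ((p \o T) @` s)); last first.
    exact/finite_image/simplex_finite/Ks.
  move=> x [/DC[v V0v <-] sx]; exists v => //; apply: sx; exact: TE.
pose P (t : R) := p (clamp t).
have cP : continuous P.
  by apply: (comp_continuous (@path_continuous _ _ _ _ p)); cts.
have Cfin : finite_set (C `&` P @` [set t | 0 <= t <= 1]).
  apply: (@real_induction R (fun s => finite_set (C `&` P @` [set t | 0 <= t <= s]))).
    apply: (@sub_finite_set _ _ [set P 0]); last exact: finite_set1.
    by move=> _ [_ [t /= t0 <-]]; congr P; lra.
  move=> t0 _.
  have /nbhs_ballP[e /= e0 He] : nbhs t0 (P @^-1` (~` (C `\ P t0))).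
    apply: cP; apply: open_nbhs_nbhs; split; last by move=> [_ []].
    by apply: closed_openC; apply: Cclosed => x [].
  exists e => // t t' tt' _ te t'e fin.
  apply: (@sub_finite_set _ _ ((C `&` P @` [set u | 0 <= u <= t]) `|` [set P t0])).
    move=> x [Cx [u /= ut' ux]]; rewrite -ux in Cx *; case: (lerP u t) => ut.
      by left; split=> //; exists u => //=; lra.
    right; apply: contrapT => ne; apply: (He u); last by split.
    by rewrite /ball /=; move: te t'e; rewrite !ltr_norml; lra.
  by rewrite finite_setU; split => //; exact: finite_set1.
have /finite_seqP[l lE] : finite_set V0.
  apply: (@sub_finite_set _ _ (\bigcup_(x in C `&` P @` [set t | 0 <= t <= 1]) support x)).
    move=> v V0v; exists (p (T v)); last exact: TE.
    split; first by exists v.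
    by exists (ival (T v)); rewrite /P ?ivalK//= ival_ge0 ival_le1.
  by apply: bigcup_finite => // x _; exact: support_finite.
by exists l => t v ptv; rewrite -lE; exists t.
Qed.

(** Near [j] the support of [g] can only grow, and it is one of the finitely
    many subsets of [l], here enumerated by boolean masks.  For each of them that is
    a simplex containing the support of [g j], openness of the target set is a
    condition on coordinates. *)
Lemma realization_continuous (J : topologicalType) (g : J -> RK) (l : seq V) :
  (forall j, support (g j) `<=` [set` l]) ->
  (forall v, continuous (fun j => bary (g j) v)) -> continuous g.
Proof.
move=> gl cg.
have cb : continuous (fun j => bary (g j) : {ptws V -> R}) by exact: ptws_continuous.
apply/continuousP => O oO; rewrite openE => j Oj.
have near_mask (m : (size l).-tuple bool) : \forall j' \near j,
    support (g j') = [set` mask m l] -> O (g j').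
  have [Km|nKm] := pselect (simplex K [set` mask m l]); last first.
    by apply: nearW => j' gj'; case: nKm; rewrite -gj'; exact: bary_simplex.
  have [W oW OW] := oO _ Km.
  have [sub|/existsNP[v /not_implyP[gv nv]]] :=
    pselect (support (g j) `<=` [set` mask m l]).
    have Wj : W (bary (g j)).
      by have [] : (@bary R V K @^-1` W `&` closed_simplex [set` mask m l]) (g j)
        by rewrite -OW.
    have : nbhs j ((fun j => bary (g j) : {ptws V -> R}) @^-1` W).
      by apply: cb; exact: open_nbhs_nbhs.
    apply: filterS => j' Wj' gj'.
    have [] : (O `&` closed_simplex [set` mask m l]) (g j') => //.
    by rewrite OW; split=> //; rewrite -gj'.
  have : \forall j' \near j, bary (g j') v != 0.
    apply: (cg v j [set r : R | r != 0]); apply: open_nbhs_nbhs.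
    by split; [exact: open_neq|exact: gv].
  apply: filterS => j' gj'v gj'; case: nv; rewrite -gj'; exact: gj'v.
have : \forall j' \near j, forall m : (size l).-tuple bool,
    support (g j') = [set` mask m l] -> O (g j') by exact: filter_forall.
apply: filterS => j' Hj'.
apply: (Hj' (map_tuple (fun v => v \in support (g j')) (in_tuple l))).
rewrite /= -filter_mask; apply/seteqP; split=> v /=; rewrite mem_filter.
  by move=> gv; rewrite mem_set//=; exact: (gl j').
by move=> /andP[/set_mem].
Qed.

End Realization.

(** * Normalized weights and maximal coordinates *)

Section Normalize.
Context (R : realType) (V : choiceType) (K : simplicial_complex V) (w : V -> R).

Definition total : R := \sum_(v \in [set v | w v != 0]) w v.

Hypothesis w_ge0 : forall v, 0 <= w v.
Hypothesis w_simplex : simplex K [set v | w v != 0].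

Lemma total_gt0 : 0 < total.
Proof.
have [v wv] := simplex_neq0 w_simplex.
rewrite lt_neqAle fsumr_ge0 ?andbT//; apply/eqP => /esym t0.
move/eqP: (wv); apply.
exact: (pfsumr_eq0 (simplex_finite w_simplex) (fun v _ => w_ge0 v) t0).
Qed.

Let bw v := w v / total.

Let bw_support : [set v | bw v != 0] = [set v | w v != 0].
Proof.
apply/seteqP; split=> v /=; rewrite /bw mulf_eq0 negb_or invr_eq0.
  by case/andP.
by move=> ->; rewrite gt_eqF// total_gt0.
Qed.

Lemma normalize_ge0 v : 0 <= bw v.
Proof. by rewrite divr_ge0// ltW// total_gt0. Qed.

Lemma normalize_simplex : simplex K [set v | bw v != 0].
Proof. by rewrite bw_support. Qed.

Lemma normalize_sum : \sum_(v \in [set v | bw v != 0]) bw v = 1.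
Proof. by rewrite bw_support -mulr_fsuml mulfV// gt_eqF// total_gt0. Qed.

Definition normalize : realization R K :=
  Realization normalize_ge0 normalize_simplex normalize_sum.

End Normalize.

Lemma total_seq (R : realType) (V : choiceType) (w : V -> R) (l : seq V) :
  uniq l -> [set v | w v != 0] `<=` [set` l] -> total w = \sum_(v <- l) w v.
Proof.
move=> ul wl; rewrite /total (fsbig_fwiden l)// => v [_ /=].
by move=> /negP; rewrite negbK => /eqP.
Qed.

Lemma seq_argmax (R : realType) (T : eqType) (f : T -> R) (l : seq T) :
  l != [::] -> exists2 v, v \in l & forall u, u \in l -> f u <= f v.
Proof.
elim: l => // a [_ _|b l /(_ isT)[v vl vmax] _].
  by exists a; rewrite ?inE// => u; rewrite inE => /eqP ->.
have [av|va] := lerP (f a) (f v).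
  by exists v => [|u]; rewrite in_cons ?vl ?orbT// => /predU1P[->//|/vmax].
exists a => [|u]; rewrite in_cons ?eqxx// => /predU1P[->//|/vmax uv].
exact: le_trans uv (ltW va).
Qed.

Section Peak.
Context (R : realType) (V : choiceType) (K : simplicial_complex V).
Local Notation RK := (realization R K).

Definition peak (f : RK) : set V := [set v | forall u, bary f u <= bary f v].

Lemma peak_support (f : RK) : peak f `<=` support f.
Proof.
move=> v fv; have [u fu] := simplex_neq0 (bary_simplex f).
rewrite /support /= gt_eqF//; apply: lt_le_trans (fv u).
by rewrite lt_neqAle eq_sym bary_ge0 andbT.
Qed.

Lemma peak_neq0 (f : RK) : peak f !=set0.
Proof.
have /finite_seqP[l lE] := support_finite f.
have [u fu] := simplex_neq0 (bary_simplex f).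
have ul : u \in l by have : support f u by []; rewrite lE.
have [|v vl vmax] := @seq_argmax R V (bary f) l; first by case: l ul {lE}.
exists v => u'; case: (pselect (support f u')) => [|/negP].
  by rewrite lE => /vmax.
by rewrite negbK => /eqP ->; exact: bary_ge0.
Qed.

(** On a closed simplex the condition says that each of its finitely many
    vertices outside [peak f] has a coordinate smaller than some other one. *)
Lemma peak_open (f : RK) : open [set g : RK | peak g `<=` peak f].
Proof.
rewrite open_realizationE => s Ks; have /finite_seqP[l lE] := simplex_finite Ks.
exists [set g : {ptws V -> R} |
  forall v : seq_sub l, ~ peak f (val v) -> exists u, g (val v) < g u].
  rewrite openE => g Wg.
  pose raised (v : seq_sub l) (g' : {ptws V -> R}) :=
    ~ peak f (val v) -> exists u, g' (val v) < g' u.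
  suff near_g v : nbhs g (raised v).
    exact: (@filter_forall _ _ raised _ (nbhs_filter g) near_g).
  have [fv|nfv] := pselect (peak f (val v)).
    by apply: (@filterE _ _ (nbhs_filter g)) => g' nfv.
  have [u vu] := Wg v nfv.
  have cuv : continuous (fun g : {ptws V -> R} => g u - g (val v)).
    apply: add_continuous; first exact: (@proj_continuous V (fun=> R) u).
    by apply: opp_continuous; exact: (@proj_continuous V (fun=> R) (val v)).
  have : nbhs g ((fun g : {ptws V -> R} => g u - g (val v)) @^-1` [set r | 0 < r]).
    apply: cuv; apply: open_nbhs_nbhs; split; first exact: open_gt.
    by rewrite /= subr_gt0.
  by apply: filterS => g' /=; rewrite subr_gt0 => ? _; exists u.
apply/seteqP; split=> g [gW sg]; split=> //=.
  move=> v nfv; apply: contrapT => /forallNP nu; apply: nfv; apply: gW => u.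
  by rewrite leNgt; apply/negP; exact: nu.
move=> v gv; apply: contrapT => nfv.
have vl : v \in l by have := sg _ (peak_support gv); rewrite lE.
have [u] := gW (SeqSub vl) nfv.
by rewrite ltNge gv.
Qed.

End Peak.

(** * The relation between a space and the nerve of a cover *)

Lemma sum_continuous (R : realType) (J : topologicalType) (T : Type) (l : seq T)
    (F : T -> J -> R) :
  (forall v, continuous (F v)) -> continuous (fun j => \sum_(v <- l) F v j).
Proof.
move=> cF; elim: l => [|v l IHl].
  by under eq_fun do rewrite big_nil; exact: cst_continuous.
by under eq_fun do rewrite big_cons; exact: add_continuous.
Qed.

Lemma max0_continuous (R : realType) (J : topologicalType) (f : J -> R) :
  continuous f -> continuous (fun j => Num.max 0 (f j)).
Proof. by move=> cf j; apply: continuous_max; [exact: cst_continuous|exact: cf]. Qed.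

Section NerveCorrespondence.
Context (R : realType) (X : topologicalType) (U : set (set X)).
Local Notation I := (unit_interval R).
Local Notation N := (realization R (nerve U)).

(** That [x] lies in every set of the support of [f] is not an open condition,
    because the support can grow near [f]; that [x] lies in some set of the
    support is open, but its fibers over [f] are unions of members of the cover,
    whose simple connectedness would need an argument of its own.  Restricting
    to the maximal coordinates gives both openness and intersections. *)
Definition peak_at (x : X) (f : N) : Prop := forall A, peak f A -> A x.

Section Contraction.
Context (x : X) (A0 : set X) (UA0 : U A0) (A0x : A0 x).

(** Unnormalized coordinates of the contraction to the vertex [A0].  Until time
    [1 / 2] the sets that miss [x] fade out, faster than those that contain
    [x], so that the maximum stays at sets containing [x]; the support does
    not grow.  After time [1 / 2] only sets containing [x] are left, and
    together with [A0] they span a simplex: so [A0] can receive weight. *)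
Definition pull (s : R) (f : set X -> R) (A : set X) : R :=
  f A * (if `[< A x >] then 1 - s else Num.max 0 (1 - 2 * s)) +
  (A == A0)%:R * Num.max 0 (2 * s - 1).

Lemma pull_ge0 (s : I) (f : N) A : 0 <= pull (ival s) (bary f) A.
Proof.
apply: addr_ge0; apply: mulr_ge0; rewrite ?bary_ge0 ?ler0n//.
  by case: ifP => _; rewrite ?subr_ge0 ?ival_le1// le_max lexx.
by rewrite le_max lexx.
Qed.

Lemma pull0 (f : N) : pull 0 (bary f) = bary f.
Proof.
apply/funext => A; rewrite /pull !mulr0 !subr0 sub0r.
rewrite (max_idPl (lerN10 R)) (max_idPr (@ler01 R)) mulr0 addr0.
by rewrite if_same mulr1.
Qed.

Lemma pull1 (f : N) A : pull 1 (bary f) A = (A == A0)%:R.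
Proof.
rewrite /pull !mulr1 subrr (max_idPl (_ : 1 - 2 <= 0)); last by lra.
rewrite if_same mulr0 add0r (_ : 2 - 1 = 1); last by lra.
by rewrite (max_idPr ler01) mulr1.
Qed.

Lemma pull_simplex (s : I) (f : N) : peak_at x f ->
  simplex (nerve U) [set A | pull (ival s) (bary f) A != 0].
Proof.
move=> fx; have s0 := ival_ge0 s; have s1 := ival_le1 s.
have [fin _ fU _] := bary_simplex f.
have [s2|s2] := lerP (2 * ival s) 1.
  have sub : [set A | pull (ival s) (bary f) A != 0] `<=` support f.
    move=> A /=; rewrite /pull (max_idPl (_ : 2 * ival s - 1 <= 0)); last by lra.
    by rewrite mulr0 addr0 mulf_eq0 negb_or => /andP[].
  apply: nerve_face (bary_simplex f) sub _.
  have [B fB] := peak_neq0 f; exists B => /=.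
  rewrite /pull (max_idPl (_ : 2 * ival s - 1 <= 0)); last by lra.
  rewrite mulr0 addr0 mulf_neq0//; first exact: peak_support.
  by rewrite asboolT; [lra|exact: fx].
have sub A : pull (ival s) (bary f) A != 0 -> A = A0 \/ support f A /\ A x.
  rewrite /pull (max_idPl (_ : 1 - 2 * ival s <= 0)); last by lra.
  have [->|/eqP nA] := pselect (A = A0); first by left.
  rewrite (negbTE nA) mul0r addr0; case: asboolP => Ax; last by rewrite mulr0 eqxx.
  by rewrite mulf_eq0 negb_or => /andP[fA _]; right.
split.
- apply: (@sub_finite_set _ _ (A0 |` support f)).
    by move=> A /sub[->|[fA _]]; [left|right].
  by rewrite finite_setU; split.
- exists A0 => /=; rewrite /pull eqxx mul1r.
  rewrite (max_idPr (_ : 0 <= 2 * ival s - 1)); last by lra.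
  rewrite gt_eqF// ltr_wpDl//; last by lra.
  by apply: mulr_ge0; rewrite ?bary_ge0// asboolT// subr_ge0.
- by move=> A /sub[->//|[/fU]].
- by exists x => A /sub[->//|[]].
Qed.

Definition contract (s : I) (f : N) : N :=
  match pselect (peak_at x f) with
  | left fx => normalize (pull_ge0 s f) (pull_simplex s fx)
  | right _ => f
  end.

Lemma bary_contract (s : I) (f : N) (A : set X) : peak_at x f ->
  bary (contract s f) A =
  pull (ival s) (bary f) A / total (pull (ival s) (bary f)).
Proof. by move=> fx; rewrite /contract; case: pselect. Qed.

Lemma contract0 (f : N) : peak_at x f -> contract zero f = f.
Proof.
move=> fx; apply: bary_inj; apply/funext => A.
by rewrite bary_contract// ival0 pull0 /total bary_sum divr1.
Qed.

Lemma contract1 (f : N) : peak_at x f ->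
  contract one f = vertex R (nerve_vertex UA0 A0x).
Proof.
move=> fx; apply: bary_inj; apply/funext => A.
rewrite bary_contract// ival1 (_ : pull 1 (bary f) = fun A => (A == A0)%:R).
  by rewrite /total (vertex_sum R A0) divr1.
by apply/funext => B; rewrite pull1.
Qed.

Lemma contract_peak (s : I) (f : N) : peak_at x f -> peak_at x (contract s f).
Proof.
move=> fx A Apeak; apply: contrapT => nAx.
have s0 := ival_ge0 s; have s1 := ival_le1 s.
have pullA B : pull (ival s) (bary f) B <= pull (ival s) (bary f) A.
  have := Apeak B; rewrite !bary_contract// ler_pM2r// invr_gt0.
  exact: total_gt0 (pull_ge0 s f) (pull_simplex s fx).
have nA : (A == A0) = false by apply/eqP => AE; apply: nAx; rewrite AE.
have pA : pull (ival s) (bary f) A = bary f A * Num.max 0 (1 - 2 * ival s).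
  by rewrite /pull nA mul0r addr0 asboolF.
have [sE|s_neq1] := eqVneq (ival s) 1.
  have := pullA A0; rewrite pA sE pull1 eqxx (max_idPl (_ : 1 - 2 * 1 <= 0)); last by lra.
  by rewrite mulr0 ler10.
have s_lt1 : 0 < 1 - ival s by rewrite subr_gt0 lt_neqAle s_neq1.
apply: nAx; apply: (fx A) => B'.
have [B fB] := peak_neq0 f; apply: le_trans (fB B') _.
have : bary f B * (1 - ival s) <= bary f A * (1 - ival s).
  apply: le_trans (_ : _ <= pull (ival s) (bary f) B) _.
    rewrite /pull asboolT; last exact: fx.
    by rewrite lerDl mulr_ge0// le_max lexx.
  apply: le_trans (pullA B) _; rewrite pA ler_wpM2l ?bary_ge0//.
  by rewrite ge_max; lra.
by rewrite ler_pM2r.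
Qed.

Lemma contract_continuous (f g : N) (p : {path I from f to g in N}) :
  (forall t, peak_at x (p t)) -> continuous (fun w : I * I => contract w.1 (p w.2)).
Proof.
move=> px; have [l pl] := path_finite_support p.
have cp : continuous (fun w : I * I => p w.2).
  by apply: (comp_continuous (@path_continuous _ _ _ _ p)); cts.
have cpull A : continuous (fun w : I * I => pull (ival w.1) (bary (p w.2)) A).
  rewrite /pull; apply: add_continuous; apply: mul_continuous; cts.
  - exact: (comp_continuous (@bary_continuous R _ (nerve U) A) cp).
  - by case: `[< A x >]; [|apply: max0_continuous]; cts.
  - by apply: max0_continuous; cts.
pose l' := undup (A0 :: l).
have pull_l' (w : I * I) : [set A | pull (ival w.1) (bary (p w.2)) A != 0] `<=` [set` l'].
  move=> A /=; rewrite mem_undup inE; apply: contraNT; rewrite negb_or.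
  move=> /andP[nA nl]; rewrite /pull (negbTE nA) mul0r addr0 mulf_eq0.
  apply/orP; left; apply/negPn; apply: contra nl => pA; exact: (pl w.2).
apply: (@realization_continuous _ _ _ _ _ l') => [w|A].
  apply: subset_trans (pull_l' w) => A; rewrite /support /= bary_contract//.
  by rewrite mulf_eq0 negb_or => /andP[].
have -> : (fun w : I * I => bary (contract w.1 (p w.2)) A) = (fun w : I * I =>
    pull (ival w.1) (bary (p w.2)) A *
    (\sum_(B <- l') pull (ival w.1) (bary (p w.2)) B)^-1).
  apply/funext => w; rewrite bary_contract// (total_seq (l := l'))//.
  exact: undup_uniq.
apply: mul_continuous => // w.
apply: cvgV; last exact: sum_continuous.
rewrite -total_seq ?undup_uniq// gt_eqF//.
exact: total_gt0 (pull_ge0 _ _) (pull_simplex _ (px _)).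
Qed.

End Contraction.

Hypothesis U_open : forall A : set X, U A -> open A.
Hypothesis U_cover : \bigcup_(A in U) A = [set: X].
Hypothesis U_sc : forall A : set X, U A -> simply_connected R (set_type A).
Hypothesis U_cap : nonempty_setI_closed U.

Lemma peak_vertex (A : set X) (vA : simplex (nerve U) [set A]) :
  peak (vertex R vA) = [set A].
Proof.
apply/seteqP; split=> B.
  move=> /peak_support; rewrite /support /=.
  by case: (B =P A) => // _ /eqP[].
by move=> -> C /=; rewrite eqxx; case: eqP => // _; exact: ler01.
Qed.

Lemma peak_bigcap (f : N) : U (\bigcap_(A in peak f) A) /\
  \bigcap_(A in peak f) A !=set0.
Proof.
have [fin _ fU [y fy]] : simplex (nerve U) (peak f).
  exact: nerve_face (bary_simplex f) (@peak_support _ _ _ f) (peak_neq0 f).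
have ne : \bigcap_(A in peak f) A !=set0 by exists y.
by split=> //; apply: U_cap => //; exact: peak_neq0.
Qed.

Lemma peak_at_open : open [set w : X * N | peak_at w.1 w.2].
Proof.
rewrite openE => -[x f] /= fx.
exists (\bigcap_(A in peak f) A, [set g : N | peak g `<=` peak f]) => /=.
  split; apply: open_nbhs_nbhs; split=> //; last exact: peak_open.
  by apply: U_open; have [] := peak_bigcap f.
by move=> [y g] [/= fy gf] A /gf; exact: fy.
Qed.

Lemma peak_at_cover (x : X) : exists f : N, peak_at x f.
Proof.
have : [set: X] x by []; rewrite -U_cover => -[A UA Ax].
by exists (vertex R (nerve_vertex UA Ax)) => B; rewrite peak_vertex => ->.
Qed.

Lemma peak_at_fiber_nerve (x : X) : simply_connected_in R (peak_at x).
Proof.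
have : [set: X] x by []; rewrite -U_cover => -[A UA Ax].
apply: (@simply_connected_contraction _ _ _ (contract UA Ax)).
- exact: contract0.
- exact: contract1.
- by move=> s f; exact: contract_peak.
- by move=> f g p; exact: contract_continuous.
Qed.

Lemma peak_at_fiber_space (f : N) : simply_connected_in R (peak_at^~ f).
Proof.
have -> : peak_at^~ f = \bigcap_(A in peak f) A by [].
by apply: simply_connected_subspace; apply: U_sc; have [] := peak_bigcap f.
Qed.

End NerveCorrespondence.

Theorem corollary4p4p6 (R : realType) (X : topologicalType)
    (U : set (set X))
    (U_open : forall A : set X, U A -> open A)
    (U_cover : \bigcup_(A in U) A = [set: X])
    (U_sc : forall A : set X, U A -> simply_connected R (set_type A))
    (U_cap : nonempty_setI_closed U)
    (x : X) (A : set X) (UA : U A) (Ax : A x) :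
  exists f : {multiplicative pi1 R x -> pi1 R (vertex R (nerve_vertex UA Ax))},
    bijective f.
Proof.
apply: (@pi1_correspondence R X (realization R (nerve U)) (@peak_at R X U)).
- exact: peak_at_open.
- by move=> y; split; [exact: peak_at_cover|exact: peak_at_fiber_nerve].
- move=> f; split; last exact: peak_at_fiber_space.
  by have [_ [y fy]] := peak_bigcap U_cap f; exists y.
- by move=> B; rewrite peak_vertex => ->.
Qed.
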